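(* Let $S\in\mathbb{S}^2_+$, and put $a=\frac{S_{11}+S_{22}}{2}$ and $b=S_{12}$. For the bivariate correlation model, the entropy loss function $\rho\mapsto I(S\|\Sigma_\rho)$ has at least one positive definite critical point. It has three positive definite critical points (i.e. three distinct ones) if and only if $\Delta_f(b,a)>0$ and $a<\frac12$, where $$\Delta_f(b,a)=-4\big[b^4-(a^2+8a-11)b^2+(2a-1)^3\big].$$
   Context: $\mathbb{S}^n_+$ denotes the set of real symmetric positive definite $n\times n$ matrices. For $\Sigma_1,\Sigma_2\in\mathbb{S}^n_+$, $I(\Sigma_1\|\Sigma_2)=\mathrm{trace}(\Sigma_1\Sigma_2^{-1})-\log\det(\Sigma_1\Sigma_2^{-1})-n$; for fixed $S\in\mathbb{S}^n_+$ the entropy loss is $\Sigma\mapsto I(S\|\Sigma)$. The bivariate correlation model ($n=2$) consists of the matrices $\Sigma_\rho=\begin{bmatrix}1&\rho\\ \rho&1\end{bmatrix}$ with $\rho\in(-1,1)$. A critical point is a zero of the derivative with respect to $\rho$ of the entropy loss; equivalently, since this derivative equals $\frac{2}{(1-\rho^2)^2}f(\rho)$, a root of the cubic $f(\rho)=\rho^3-b\rho^2-\rho(1-2a)-b$. It is positive definite if $\rho\in(-1,1)$. $\Delta_f$ is the discriminant of $f$. *)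

(* Defs.v *)
From HB Require Import structures.
From mathcomp Require Import all_boot all_order all_algebra.
From mathcomp Require Import all_classical all_reals all_analysis.

Set Implicit Arguments.
Unset Strict Implicit.
Unset Printing Implicit Defensive.

Import Order.TTheory GRing.Theory Num.Theory.
Import numFieldNormedType.Exports.

Local Open Scope classical_set_scope.
Local Open Scope ring_scope.

Definition posdef (R : realType) (n : nat) (A : 'M[R]_n) : Prop :=
  A^T = A /\ forall v : 'cV[R]_n, v != 0 -> 0 < (v^T *m A *m v) 0 0.

Definition entropy_loss (R : realType) (n : nat) (A B : 'M[R]_n) : R :=
  \tr (A *m invmx B) - ln (\det (A *m invmx B)) - n%:R.

Definition corr_mx (R : realType) (rho : R) : 'M[R]_2 :=
  \matrix_(i, j) (if i == j then 1 else rho).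

(* [corr_mx rho] is positive definite exactly when -1 < rho < 1; outside this
   range the library's totalized [ln] and [invmx] make [entropy_loss]
   meaningless. *)
Definition pd_critical_points (R : realType) (S : 'M[R]_2) : set R :=
  [set rho : R | -1 < rho < 1 /\
     is_derive rho (1 : R) (fun r : R => entropy_loss S (corr_mx r)) (0 : R)].

(* Numerator of the derivative of [fun rho => entropy_loss S (corr_mx rho)],
   up to the factor 2 / (1 - rho ^+ 2) ^+ 2, for a = (S 0 0 + S 1 1) / 2 and
   b = S 0 1. *)
Definition critical_cubic (R : realType) (b a : R) : {poly R} :=
  'X^3 - b *: 'X^2 - (1 - 2 * a) *: 'X - b%:P.

(* (-1)^(d(d-1)/2) Res(p, p') / lead_coef p with d = deg p. The sign convention
   is the usual one: the library's Sylvester matrix lists coefficients and rows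
   in increasing degree, which changes the determinant by (-1)^(d(d-1)) = 1. *)
Definition discriminant (R : realType) (p : {poly R}) : R :=
  (-1) ^+ 'C((size p).-1, 2) * resultant p p^`() / lead_coef p.

(* Main.v *)
Require Import Defs.
From HB Require Import structures.
From mathcomp Require Import all_boot all_order all_algebra.
From mathcomp Require Import all_classical all_reals all_analysis.
From mathcomp Require Import ring lra.

Set Implicit Arguments.
Unset Strict Implicit.
Unset Printing Implicit Defensive.

Import Order.TTheory GRing.Theory Num.Theory.
Import numFieldNormedType.Exports.

Local Open Scope classical_set_scope.
Local Open Scope ring_scope.

(** The entropy loss of [corr_mx r] is, for -1 < r < 1,
    (2 a - 2 b r) / (1 - r ^+ 2) + ln (1 - r ^+ 2) + constant, and
    differentiating it shows that the critical points are the roots in (-1, 1)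
    of the cubic f ([pd_critical_pointsE]). Testing positive definiteness of S
    on the vectors (1, 1) and (1, -1) gives |b| < a. Since f(1) = 2 (a - b) and
    f(-1) = - 2 (a + b), f changes sign on (-1, 1) and has a root r there.

    The peculiarity of f is that its first and third elementary symmetric
    functions of the roots agree: e1 = e3 = b, while e2 = 2 a - 1. If all three
    roots r, s, t are distinct and lie in (-1, 1), the discriminant is
    ((r - s) (s - t) (r - t))^2 > 0, and e1^2 = e3^2 < r^2 + s^2 + t^2 forces
    e2 < 0, i.e. a < 1/2 ([distinct_roots_lt_half]).

    Conversely, divide f by x - r: f = (x - r) g with g = x^2 + p x + q. The
    discriminant of f is (p^2 - 4 q) g(r)^2, so its positivity says that g has
    two distinct real roots, both different from r. The values g(1), g(-1) are
    positive, because those of f at 1 and -1 have the signs of 1 - r and -1 - r.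
    So the roots of g either both lie in (-1, 1), or both lie on the same side
    outside, in which case q > 1; and e1 = e3 together with a < 1/2 excludes
    q > 1 ([critical_cubic_three_roots]). *)

(** * Determinants, resultants and the discriminant of a cubic *)

(** The Sylvester matrix has its dimension given by the sizes of the
    polynomials; naming the degrees gives a matrix of literal dimension. *)
Lemma resultant_matrixE (R : nzRingType) (p q : {poly R}) (dp dq : nat) :
  size p = dp.+1 -> size q = dq.+1 ->
  resultant p q = \det (\matrix_(i < dq + dp, j < dq + dp)
    (if (i < dq)%N then p`_(j - i) *+ (i <= j)%N
     else q`_(j - (i - dq)) *+ (i - dq <= j)%N)).
Proof.
move=> szp szq; have -> : dp = (size p).-1 by rewrite szp.
have -> : dq = (size q).-1 by rewrite szq.
rewrite /resultant; congr (\det _); apply/matrixP => i j.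
by rewrite Sylvester_mxE mxE; case: split_ordP => k -> //=; rewrite addKn.
Qed.

Definition minor_rows (R : pzRingType) (i : nat) (rows : seq (seq R)) :=
  [seq behead r | r <- take i rows ++ drop i.+1 rows].

(** Laplace expansion along the first column, on a list of rows so that it
    unfolds by computation, which the determinant, a sum over permutations,
    does not. *)
Fixpoint laplace_det (R : pzRingType) (n : nat) (rows : seq (seq R)) : R :=
  if n is m.+1 then
    \sum_(i <- iota 0 m.+1)
      (nth [::] rows i)`_0 * ((-1) ^+ i * laplace_det m (minor_rows i rows))
  else 1.
Arguments laplace_det : simpl never.

(** Unfolds one level only: the vanishing terms can then be discarded before
    their minors are expanded. *)
Lemma laplace_detS (R : pzRingType) (n : nat) (rows : seq (seq R)) :
  laplace_det n.+1 rows = \sum_(i <- iota 0 n.+1)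
      (nth [::] rows i)`_0 * ((-1) ^+ i * laplace_det n (minor_rows i rows)).
Proof. by []. Qed.

Lemma det_laplace (R : comNzRingType) (n : nat) (rows : seq (seq R)) :
  size rows = n ->
  \det (\matrix_(i < n, j < n) (nth [::] rows i)`_j) = laplace_det n rows.
Proof.
elim: n rows => [|n IHn] rows szr; first by rewrite det_mx00.
rewrite laplace_detS -[iota 0 n.+1]/(index_iota 0 n.+1) big_mkord.
rewrite (expand_det_col _ ord0); apply: eq_bigr => i _.
have ltin : (i < size rows)%N by rewrite szr.
have szm : size (take i rows ++ drop i.+1 rows) = n.
  rewrite size_cat size_takel ?(ltnW ltin) // size_drop szr.
  by rewrite subSS subnKC -1?ltnS -?szr.
rewrite -IHn ?size_map // mxE /cofactor addn0; congr (_ * (_ * \det _)).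
apply/matrixP => k j; rewrite !mxE (nth_map [::]) ?szm // nth_behead nth_cat.
rewrite size_takel ?(ltnW ltin) //= /bump.
case: (ltnP k i) => [ltki|leik]; first by rewrite nth_take.
by rewrite nth_drop addSn subnKC.
Qed.

Lemma discriminant_monic_cubic (R : realType) (c2 c1 c0 : R) :
  discriminant (Poly [:: c0; c1; c2; 1]) =
  c2 ^+ 2 * c1 ^+ 2 - 4 * c1 ^+ 3 - 4 * c2 ^+ 3 * c0 - 27 * c0 ^+ 2
  + 18 * c2 * c1 * c0.
Proof.
set p := Poly _.
have szp : size p = 4 by rewrite (PolyK (c := 0)) //= oner_neq0.
have dpE : p^`() = Poly [:: c1; c2 *+ 2; 3].
  apply/polyP => i; rewrite coef_deriv !coef_Poly.
  by case: i => [|[|[|i]]] //=; rewrite !nth_nil mul0rn.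
have szdp : size p^`() = 3 by rewrite dpE (PolyK (c := 0)) //= pnatr_eq0.
rewrite /discriminant lead_coefE szp coef_Poly divr1.
rewrite (resultant_matrixE szp szdp).
pose rows := [:: [:: c0; c1; c2; 1; 0]; [:: 0; c0; c1; c2; 1];
  [:: c1; c2 *+ 2; 3; 0; 0]; [:: 0; c1; c2 *+ 2; 3; 0];
  [:: 0; 0; c1; c2 *+ 2; 3]].
rewrite [X in \det X](_ : _ = \matrix_(i < 5, j < 5) (nth [::] rows i)`_j).
  rewrite (@det_laplace _ 5 rows) // /rows.
  do 5! rewrite !laplace_detS /minor_rows /= !big_cons !big_nil /=
    !(mul0r, addr0, add0r).
  by rewrite /laplace_det; ring.
apply/matrixP => i j; rewrite !mxE dpE !coef_Poly.
by case: i => [[|[|[|[|[|i]]]]] // hi]; case: j => [[|[|[|[|[|j]]]]] // hj].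
Qed.

(** * Two by two matrices and the entropy loss *)

Lemma sum_ord2 (V : nmodType) (F : 'I_2 -> V) : \sum_i F i = F 0 + F 1.
Proof.
rewrite !big_ord_recl big_ord0 addr0; congr (_ + F _); exact: val_inj.
Qed.

Lemma det_mx2 (R : comNzRingType) (A : 'M[R]_2) :
  \det A = A 0 0 * A 1 1 - A 0 1 * A 1 0.
Proof.
rewrite (expand_det_row _ 0) sum_ord2 /cofactor !det_mx11 !mxE /=.
have -> : lift 0 0 = 1 :> 'I_2 by exact: val_inj.
have -> : lift 1 0 = 0 :> 'I_2 by exact: val_inj.
by rewrite expr0 expr1 mul1r mulN1r mulrN.
Qed.

Lemma mxtrace2 (R : pzSemiRingType) (A : 'M[R]_2) : \tr A = A 0 0 + A 1 1.
Proof. exact: sum_ord2. Qed.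

Lemma posdef_sym (R : realType) (n : nat) (S : 'M[R]_n) (i j : 'I_n) :
  posdef S -> S i j = S j i.
Proof. by case=> symS _; rewrite -[in LHS]symS mxE. Qed.

Lemma posdef_quadratic_form (R : realType) (S : 'M[R]_2) (x y : R) : posdef S ->
  (x != 0) || (y != 0) ->
  0 < S 0 0 * x ^+ 2 + 2 * S 0 1 * x * y + S 1 1 * y ^+ 2.
Proof.
move=> pdS xy0; have [_ posS] := pdS.
pose v : 'cV[R]_2 := \col_i (if i == 0 then x else y).
have /posS : v != 0.
  apply: contraTneq xy0 => v0; rewrite negb_or !negbK.
  have : v 0 0 = x /\ v 1 0 = y by rewrite !mxE.
  by rewrite v0 !mxE => -[<- <-]; rewrite eqxx.
rewrite mxE sum_ord2 !mxE !sum_ord2 !mxE /= (posdef_sym 1 0 pdS).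
by congr (_ < _); ring.
Qed.

(** Testing on the vector (- S 0 1, S 0 0) completes the square: the form takes
    the value S 0 0 * \det S. *)
Lemma posdef_det_gt0 (R : realType) (S : 'M[R]_2) : posdef S -> 0 < \det S.
Proof.
move=> pdS; have S00 : 0 < S 0 0.
  have := @posdef_quadratic_form _ S 1 0 pdS.
  by rewrite oner_neq0 => /(_ isT); nra.
have := @posdef_quadratic_form _ S (- S 0 1) (S 0 0) pdS.
rewrite (gt_eqF S00) orbT => /(_ isT) pos.
rewrite det_mx2 (posdef_sym 1 0 pdS) -(pmulr_rgt0 _ S00).
by move: pos; congr (_ < _); ring.
Qed.

(** Positivity of the quadratic form at (1, 1) and (1, -1). *)
Lemma posdef_offdiag_lt (R : realType) (S : 'M[R]_2) : posdef S ->
  `|S 0 1| < (S 0 0 + S 1 1) / 2.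
Proof.
move=> pdS; rewrite ltr_norml.
have := @posdef_quadratic_form _ S 1 1 pdS.
have := @posdef_quadratic_form _ S 1 (-1) pdS.
by rewrite oner_neq0 => /(_ isT) ? /(_ isT) ?; lra.
Qed.

Lemma invmx_corr_mx (R : realType) (r : R) : 1 - r ^+ 2 != 0 ->
  invmx (corr_mx r) = (1 - r ^+ 2)^-1 *: corr_mx (- r).
Proof.
move=> r1.
have eq1 : corr_mx r *m ((1 - r ^+ 2)^-1 *: corr_mx (- r)) = 1%:M.
  rewrite -scalemxAr; apply: (canLR (scalerK r1)).
  apply/matrixP => i j; rewrite mxE sum_ord2 !mxE /=.
  by case: i => [[|[|//]] hi]; case: j => [[|[|//]] hj] /=;
    rewrite -?val_eqE /=; ring.
have [u _] := mulmx1_unit eq1.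
by rewrite -[RHS](mulKmx u) eq1 mulmx1.
Qed.

Lemma entropy_loss_corr (R : realType) (S : 'M[R]_2) (r : R) :
  posdef S -> -1 < r < 1 ->
  entropy_loss S (corr_mx r) =
  (S 0 0 + S 1 1 - 2 * S 0 1 * r) / (1 - r ^+ 2) + ln (1 - r ^+ 2)
  - ln (\det S) - 2.
Proof.
move=> pdS /andP[r1 r2]; have D : 0 < 1 - r ^+ 2 by nra.
rewrite /entropy_loss det_mulmx det_inv.
have -> : \det (corr_mx r) = 1 - r ^+ 2 by rewrite det_mx2 !mxE /= mulr1.
rewrite ln_div ?posrE ?posdef_det_gt0 // invmx_corr_mx ?gt_eqF //.
rewrite -scalemxAr mxtraceZ mxtrace2 !mxE !sum_ord2 !mxE /=.
by rewrite (posdef_sym 1 0 pdS); ring.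
Qed.

Lemma is_derive_entropy_loss (R : realType) (S : 'M[R]_2) (a b r : R) :
  posdef S -> a = (S 0 0 + S 1 1) / 2 -> b = S 0 1 -> -1 < r < 1 ->
  is_derive r (1 : R) (fun x => entropy_loss S (corr_mx x))
    (2 / (1 - r ^+ 2) ^+ 2 * (critical_cubic b a).[r]).
Proof.
move=> pdS ha hb r1; have D : 0 < 1 - r ^+ 2 by case/andP: r1; nra.
pose g (x : R) : R := 1 - x ^+ 2.
have dg : is_derive r (1 : R) g (- (2 * r)).
  apply: is_derive_eq; rewrite ?scaler1 /GRing.scale /=; ring.
have dV := @is_deriveV _ g r _ _ (lt0r_neq0 D) dg.
have dl : is_derive r (1 : R) (@ln R \o g) ((g r)^-1 * - (2 * r)).
  by apply: (@is_derive1_comp _ (@ln R) g); exact: is_derive1_ln.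
pose n (x : R) : R := 2 * a - 2 * b * x.
have dn : is_derive r (1 : R) n (- (2 * b)).
  by apply: is_derive_eq; rewrite ?scaler1 /GRing.scale /=; ring.
pose h := n * (fun x => (g x)^-1) + (@ln R \o g) - cst (ln (\det S) + 2).
have dh : is_derive r (1 : R) h
    (2 / (1 - r ^+ 2) ^+ 2 * (critical_cubic b a).[r]).
  apply: is_derive_eq.
  rewrite /critical_cubic !hornerE /GRing.scale /= /g /n.
  by field; rewrite gt_eqF.
apply: near_eq_is_derive dh.
have ha2 : S 0 0 + S 1 1 = 2 * a by rewrite ha; field.
(* Outside (-1, 1) the explicit formula is not valid, so only the germ at r of
   the loss is known; it determines the derivative. *)
near=> x; rewrite entropy_loss_corr // -?hb ?ha2.
  by rewrite /h /n /g !fctE /= opprD addrA.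
near: x; have : r \in `]-1, 1[ by rewrite in_itv.
by move=> /near_in_itvoo; apply: filterS => x; rewrite in_itv.
Unshelve. all: by end_near. Qed.

(** The factor 2 / (1 - r^2)^2 of the derivative does not vanish on (-1, 1). *)
Lemma pd_critical_pointsE (R : realType) (S : 'M[R]_2) (a b : R) :
  posdef S -> a = (S 0 0 + S 1 1) / 2 -> b = S 0 1 ->
  pd_critical_points S =
    [set r | -1 < r < 1 /\ (critical_cubic b a).[r] = 0].
Proof.
move=> pdS ha hb; apply/seteqP; split=> r [r1 hr]; split=> //;
  have df := is_derive_entropy_loss pdS ha hb r1.
- have : 2 / (1 - r ^+ 2) ^+ 2 * (critical_cubic b a).[r] = 0.
    by rewrite -(@derive_val _ _ _ _ _ _ _ df) (@derive_val _ _ _ _ _ _ _ hr).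
  move/eqP; rewrite mulf_eq0 => /orP[|/eqP //].
  have D : 0 < 1 - r ^+ 2 by case/andP: r1; nra.
  by rewrite gt_eqF // divr_gt0 ?exprn_gt0.
- by apply: is_derive_eq df _; rewrite hr mulr0.
Qed.

(** * The critical cubic *)

Lemma critical_cubicE (R : realType) (b a : R) :
  critical_cubic b a = Poly [:: - b; 2 * a - 1; - b; 1].
Proof.
apply/polyP => i; rewrite coef_Poly /critical_cubic !coefE.
by case: i => [|[|[|[|i]]]] /=; rewrite ?nth_nil; ring.
Qed.

Lemma discriminant_critical_cubic (R : realType) (b a : R) :
  discriminant (critical_cubic b a) =
  - 4 * (b ^+ 4 - (a ^+ 2 + 8 * a - 11) * b ^+ 2 + (2 * a - 1) ^+ 3).
Proof. by rewrite critical_cubicE discriminant_monic_cubic; ring. Qed.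

Lemma horner_critical_cubic (R : realType) (b a r : R) :
  (critical_cubic b a).[r] = r ^+ 3 - b * r ^+ 2 - (1 - 2 * a) * r - b.
Proof. by rewrite /critical_cubic !hornerE. Qed.

(** f(1) = 2 (a - b) and f(-1) = - 2 (a + b) have opposite signs. *)
Lemma critical_cubic_root_ex (R : realType) (b a : R) : `|b| < a ->
  exists2 r, -1 < r < 1 & (critical_cubic b a).[r] = 0.
Proof.
rewrite ltr_norml => /andP[ba1 ba2].
have f1 : 0 < (critical_cubic b a).[1] by rewrite horner_critical_cubic; lra.
have fN1 : (critical_cubic b a).[-1] < 0 by rewrite horner_critical_cubic; lra.
have [||r /andP[r1 r2] /eqP fr] := @poly_ivt _ (critical_cubic b a) (-1) 1.
- by lra.
- by rewrite !ltW.
exists r => //; rewrite !lt_neqAle r1 r2 !andbT.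
by apply/andP; split; apply/eqP => rE; move: fr f1 fN1;
  [rewrite -rE|rewrite rE]; lra.
Qed.

(** Vieta's relations, by dividing f(r) - f(s) and f(r) - f(t), then the
    difference of the quotients, by the differences of the roots. *)
Lemma critical_cubic_vieta (R : realType) (b a r s t : R) :
  r != s -> s != t -> r != t ->
  (critical_cubic b a).[r] = 0 -> (critical_cubic b a).[s] = 0 ->
  (critical_cubic b a).[t] = 0 ->
  [/\ r + s + t = b, r * s + s * t + r * t = 2 * a - 1 & r * s * t = b].
Proof.
rewrite -(subr_eq0 r s) -(subr_eq0 s t) -(subr_eq0 r t) !horner_critical_cubic.
move=> rs st rt fr fs ft.
have q1 : r ^+ 2 + r * s + s ^+ 2 - b * (r + s) - (1 - 2 * a) = 0.
  by apply: (mulfI rs); lra.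
have q2 : r ^+ 2 + r * t + t ^+ 2 - b * (r + t) - (1 - 2 * a) = 0.
  by apply: (mulfI rt); lra.
have e1 : r + s + t = b by apply: (mulfI st); lra.
have e2 : r * s + s * t + r * t = 2 * a - 1 by rewrite -e1 in q1; lra.
split=> //; move: fr.
have -> : 1 - 2 * a = - (r * s + s * t + r * t) by lra.
by rewrite -{1}e1 => fr; apply: subr0_eq; rewrite -fr; ring.
Qed.

(** If a >= 1/2, then e2 >= 0 and r^2 + s^2 + t^2 <= e1^2; but e1^2 = e3^2 is at
    most t^2, so that r = s = 0. *)
Lemma distinct_roots_lt_half (R : realType) (b a r s t : R) : r != s ->
  -1 < r < 1 -> -1 < s < 1 ->
  r + s + t = b -> r * s + s * t + r * t = 2 * a - 1 -> r * s * t = b ->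
  a < 1 / 2.
Proof.
move=> rs /andP[r1 r2] /andP[s1 s2] e1 e2 e3; rewrite ltNge.
apply/negP => a2.
have r2_1 : r ^+ 2 <= 1 by nra.
have s2_1 : s ^+ 2 <= 1 by nra.
have rs2 : r ^+ 2 * s ^+ 2 * t ^+ 2 <= t ^+ 2.
  by rewrite -[leRHS]mul1r ler_wpM2r ?sqr_ge0 // -[1]mulr1 ler_pM ?sqr_ge0.
have b2 : b ^+ 2 = r ^+ 2 * s ^+ 2 * t ^+ 2 by rewrite -e3; ring.
have b2' : b ^+ 2 = r ^+ 2 + s ^+ 2 + t ^+ 2 + 2 * (2 * a - 1).
  by rewrite -e1 -e2; ring.
move/eqP: rs; apply.
have r0 : r ^+ 2 = 0.
  by apply/eqP; rewrite eq_le sqr_ge0 andbT; have := sqr_ge0 s; lra.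
have s0 : s ^+ 2 = 0.
  by apply/eqP; rewrite eq_le sqr_ge0 andbT; have := sqr_ge0 r; lra.
by move/eqP: r0; move/eqP: s0; rewrite !sqrf_eq0 => /eqP -> /eqP ->.
Qed.

(** The second hypothesis says that x^2 + p x + q is positive at 1 and -1; its
    roots then lie both in (-1, 1) or both beyond the same end point, where
    their product q would exceed 1. *)
Lemma quadratic_roots_inside (R : realType) (p q : R) :
  4 * q < p ^+ 2 -> `|p| < 1 + q -> q <= 1 ->
  exists s t, [/\ s != t, -1 < s < 1, -1 < t < 1,
    s ^+ 2 + p * s + q = 0 & t ^+ 2 + p * t + q = 0].
Proof.
move=> D pq q1; pose d := Num.sqrt (p ^+ 2 - 4 * q).
have d0 : 0 < d by rewrite sqrtr_gt0 subr_gt0.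
have dd : d ^+ 2 = p ^+ 2 - 4 * q by rewrite sqr_sqrtr // subr_ge0 ltW.
(* (2 - |p|)^2 exceeds p^2 - 4 q because |p| < 1 + q, and |p| < 2. *)
have d2 : d < 2 - `|p|.
  have : d ^+ 2 < (2 - `|p|) ^+ 2.
    by rewrite dd -[p ^+ 2]real_normK ?num_real //; lra.
  by rewrite ltr_pXn2r ?nnegrE ?ltW //; lra.
have [pn1 pn2] : p <= `|p| /\ - p <= `|p| by rewrite ler_norm -normrN ler_norm.
exists ((- p + d) / 2), ((- p - d) / 2); split.
- by apply/eqP; lra.
- by apply/andP; lra.
- by apply/andP; lra.
- rewrite (_ : q = (p ^+ 2 - d ^+ 2) / 4); [by field | lra].
- rewrite (_ : q = (p ^+ 2 - d ^+ 2) / 4); [by field | lra].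
Qed.

(** Dividing f by x - r, for a root r in (-1, 1), leaves the quadratic
    x^2 + p x + q with p = r - b and q = 2 a - 1 + r p; the hypotheses give
    what [quadratic_roots_inside] asks of p and q. *)
Lemma critical_cubic_three_roots (R : realType) (b a : R) :
  `|b| < a -> a < 1 / 2 -> 0 < discriminant (critical_cubic b a) ->
  exists r s t, [/\ r != s, s != t, r != t &
    [set x | -1 < x < 1 /\ (critical_cubic b a).[x] = 0] = [set r; s; t]].
Proof.
move=> ba a2; have [r r1 fr] := critical_cubic_root_ex ba.
pose p := r - b; pose q := 2 * a - 1 + r * p.
have bE : b = r * q by move: fr; rewrite horner_critical_cubic /q /p; lra.
have fE x : (critical_cubic b a).[x] = (x - r) * (x ^+ 2 + p * x + q).
  by rewrite horner_critical_cubic {2}bE /q /p; ring.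
have -> : discriminant (critical_cubic b a) =
    (p ^+ 2 - 4 * q) * (r ^+ 2 + p * r + q) ^+ 2.
  have -> : critical_cubic b a = Poly [:: - (r * q); q - r * p; p - r; 1].
    by rewrite critical_cubicE {1}bE; congr (Poly [:: _; _; _; _]);
      rewrite /q /p; ring.
  by rewrite discriminant_monic_cubic; ring.
move=> disc0.
have gr : r ^+ 2 + p * r + q != 0.
  by apply: contraTneq disc0 => ->; rewrite expr0n mulr0 ltxx.
have D : 4 * q < p ^+ 2.
  by rewrite -subr_gt0; move: disc0; rewrite pmulr_lgt0 // exprn_even_gt0.
have q1 : q <= 1.
  (* e1 = e3 reads p = r (1 - q), hence q = 2 a - 1 + r^2 (1 - q). *)
  rewrite leNgt; apply/negP => q1.
  have qE : q = 2 * a - 1 + r ^+ 2 * (1 - q).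
    by rewrite {1}/q {1}/p {1}bE; ring.
  by have := sqr_ge0 r; nra.
have pq : `|p| < 1 + q.
  move: ba r1; rewrite ltr_norml => /andP[ba1 ba2] /andP[r1 r2].
  have g1 : 0 < (1 - r) * (1 + p + q).
    by have := fE 1; rewrite horner_critical_cubic; lra.
  have gN1 : 0 < (1 + r) * (1 - p + q).
    by have := fE (-1); rewrite horner_critical_cubic; lra.
  move: g1 gN1; rewrite !pmulr_rgt0; [|lra|lra] => g1 gN1.
  by rewrite ltr_norml; apply/andP; lra.
have [s [t [st s1 t1 gs gt]]] := quadratic_roots_inside D pq q1.
have rs : r != s by apply: contraNneq gr => ->; apply/eqP.
have rt : r != t by apply: contraNneq gr => ->; apply/eqP.
exists r, s, t; split=> //; apply/seteqP; split=> x /=.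
- move=> [_ /eqP]; rewrite fE mulf_eq0 subr_eq0 => /orP[/eqP ->|/eqP gx].
    by left; left.
  have pE : p = - (s + t).
    by apply: (mulfI (_ : s - t != 0)); rewrite ?subr_eq0 //; lra.
  have : (x - s) * (x - t) == 0 by apply/eqP; move: gx gs; rewrite pE; lra.
  by rewrite mulf_eq0 !subr_eq0 => /orP[] /eqP ->; [left; right|right].
- by case=> [[->|->]|->]; split=> //; rewrite fE ?gs ?gt ?subrr ?mul0r ?mulr0.
Qed.

Lemma card_eq_I3 (T : pointedType) (A : set T) :
  (A #= `I_3)%card <->
  exists x y z, [/\ x != y, y != z, x != z & A = [set x; y; z]].
Proof.
split=> [|[x [y [z [xy yz xz ->]]]]].
- rewrite card_eq_sym => /pcard_eqP[f].
  have f_inj (i j : nat) : (i < 3)%N -> (j < 3)%N -> i != j -> f i != f j.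
    move=> i3 j3; apply: contra_neq; apply: inj; exact: mem_set.
  exists (f 0%N), (f 1%N), (f 2%N); split; [exact: f_inj..|].
  rewrite -[LHS](image_eq f); apply/seteqP; split=> u.
    by move=> [[|[|[|i]]] //= _ <-]; [left; left|left; right|right].
  by move=> [[->|->]|->]; [exists 0%N|exists 1%N|exists 2%N].
- have -> : [set x; y; z] = nth x [:: x; y; z] @` `I_3.
    apply/seteqP; split=> u /=.
      by move=> [[->|->]|->]; [exists 0%N|exists 1%N|exists 2%N].
    by move=> [[|[|[|i]]] //= _ <-]; [left; left|left; right|right].
  apply: inj_card_eq => i j; rewrite !inE /= => i3 j3 /eqP.
  by rewrite nth_uniq //= ?inE ?negb_or ?xy ?yz ?xz // => /eqP.
Qed.

(** * The bivariate correlation model *)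

Theorem theorem3p1 (R : realType) (S : 'M[R]_2) (hS : posdef S)
    (a b : R) (ha : a = (S 0 0 + S 1 1) / 2) (hb : b = S 0 1) :
  [/\ pd_critical_points S !=set0,
      (pd_critical_points S #= `I_3)%card <->
        0 < discriminant (critical_cubic b a) /\ a < 1 / 2
    & discriminant (critical_cubic b a) =
        - 4 * (b ^+ 4 - (a ^+ 2 + 8 * a - 11) * b ^+ 2 + (2 * a - 1) ^+ 3)].
Proof.
have ba : `|b| < a by rewrite ha hb posdef_offdiag_lt.
rewrite (pd_critical_pointsE hS ha hb); split.
- by have [r r1 fr] := critical_cubic_root_ex ba; exists r.
- rewrite card_eq_I3; split=> [|[disc0 a2]]; last first.
    exact: critical_cubic_three_roots.
  move=> [r [s [t [rs st rt critE]]]].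
  have crit x : [set r; s; t] x -> -1 < x < 1 /\ (critical_cubic b a).[x] = 0.
    by rewrite -critE.
  have [r1 fr] := crit r (or_introl (or_introl erefl)).
  have [s1 fs] := crit s (or_introl (or_intror erefl)).
  have [t1 ft] := crit t (or_intror erefl).
  have [e1 e2 e3] := critical_cubic_vieta rs st rt fr fs ft.
  split; last exact: distinct_roots_lt_half e1 e2 e3.
  rewrite critical_cubicE {1}(esym e3) -e2 -e1 discriminant_monic_cubic.
  rewrite [ltRHS](_ : _ = ((r - s) * (s - t) * (r - t)) ^+ 2); last by ring.
  by rewrite exprn_even_gt0 //= !mulf_neq0 // subr_eq0.
- exact: discriminant_critical_cubic.
Qed.
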